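(* Let $K$ be an arbitrary field of characteristic $p>0$. Then for each subgroup $H$ of $\mathrm{Aut}_K(K[x])$ there is a monic polynomial $f_H\in K[x]$ such that $G_{f_H}(K)=H$: 1. For $H=\{e\}$, $f_H=x(x+1)^2$. 2. For $H=\langle\sigma_{\lambda_n,(1-\lambda_n)\nu}\rangle$ where $\lambda_n\in K$ is a primitive $n$'th root of unity, $n\ge2$, and $\nu\in K$, $f_H=(x-\nu)^n-1$. 3. For $H=\mathrm{Sh}_V$ where $V$ is a nonzero finite dimensional $\mathbb F_p$-subspace of $K$: (a) if $K=\mathbb F_{p^n}$ then $f_H(x)=f_V(x-\nu)-\rho$ where $\nu\in K$ and $\rho$ is any element of $\mathbb F_{p^n}$ that does not belong to the image of the map $\mathbb F_{p^n}\to\mathbb F_{p^n}$, $a\mapsto f_V(a-\nu)$ (this map is not surjective since the set $\nu+V$ is mapped to $0$); (b) if $|K|=\infty$ then $f_H(x)=f_V(x)f_V^2(x-\nu)$ where $\nu\in K\setminus V$. 4. For $H=\mathrm{Sh}_V\rtimes\langle\sigma_{\lambda_n,(1-\lambda_n)\nu}\rangle$ where $V$ is a nonzero finite dimensional $\mathbb F_p$-subspace of $K$, $\mathbb F_{p^e}$ is its multiplier field, $\nu\in K$, and $\lambda_n$ is a primitive $n$'th root of unity, $n\ge2$, such that $\lambda_nV\subseteq V$, $$f_H(x)=\begin{cases}f_V(x-\nu)&\text{if }n=p^e-1,\\ f_V^n(x-\nu)+1&\text{if }n<p^e-1.\end{cases}$$ 5. For $H=\mathbb T_\nu(K)=\{\sigma_{\lambda,(1-\lambda)\nu}\mid\lambda\in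 K^\times\}$ with $\nu\in K$, $f_H=x-\nu$. 6. For $H=\mathrm{Aut}_K(K[x])$, $f_H=\begin{cases}1&\text{if }|K|=\infty,\\ x^{p^n}-x&\text{if }K=\mathbb F_{p^n}.\end{cases}$
   Context: $\mathrm{Aut}_K(K[x])=\{\sigma_{\lambda,\mu}\mid\lambda\in K^\times,\mu\in K\}$, $\sigma_{\lambda,\mu}(x)=\lambda x+\mu$. The eigengroup of $f\in K[x]$ is $G_f=G_f(K)=\{\sigma\in\mathrm{Aut}_K(K[x])\mid\sigma(f)=\lambda_\sigma f\text{ for some }\lambda_\sigma\in K^\times\}$. For an $\mathbb F_p$-subspace $V$ of $K$, $\mathrm{Sh}_V=\{\sigma_{1,v}\mid v\in V\}$. For $V$ finite dimensional, $f_V(x)=\prod_{v\in V}(x-v)$ and $f_V^i(x-\nu):=(f_V(x-\nu))^i$; the multiplier field of $V\ne0$ is the largest finite field $\mathbb F_{p^e}$ such that $\mathbb F_{p^e}V\subseteq V$.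
   Formalization: The opening claim fails for infinite K (e.g. H = Sh_K is no eigengroup); it is proved for every H when K is finite, and in general for exactly the subgroups listed in 1–6, which are shown to be the only subgroups equal to G_f for a monic f. *)

(* Defs.v *)
From HB Require Import structures.
From mathcomp Require Import all_boot all_order all_algebra.
From mathcomp Require Import boolp classical_sets functions cardinality fsbigop.

Set Implicit Arguments.
Unset Strict Implicit.
Unset Printing Implicit Defensive.

Import GRing.Theory.
Local Open Scope classical_set_scope.
Local Open Scope ring_scope.

Section Definitions.
Variable K : fieldType.

Definition endo : Type := {poly K} -> {poly K}.

(* Aut_K(K[x]): the K-algebra automorphisms of K[x]. *)
Definition AutPoly : set endo :=
  [set s | [/\ linear s, GRing.monoid_morphism s & bijective s]].

(* The K-algebra endomorphism determined by x |-> lam x + mu. *)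
Definition sigma (lam mu : K) : endo :=
  fun f => f \Po (lam *: 'X + mu%:P).

Definition is_subgroup (H : set endo) : Prop :=
  [/\ H `<=` AutPoly,
      H idfun,
      forall s t, H s -> H t -> H (s \o t)
    & forall s, H s -> exists t, [/\ H t, cancel s t & cancel t s]].

Definition generated (s : endo) : set endo :=
  [set t | forall H, is_subgroup H -> H s -> H t].

Definition is_normal (N G : set endo) : Prop :=
  N `<=` G /\
  forall g h n, G g -> cancel g h -> cancel h g -> N n -> N (g \o n \o h).

(* G is the internal semidirect product of N (normal) and C. *)
Definition is_sdprod (G N C : set endo) : Prop :=
  [/\ is_subgroup G /\ is_normal N G, is_subgroup N, is_subgroup C,
      N `&` C = [set idfun]
    & G = [set s | exists n c, [/\ N n, C c & s = n \o c]]].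

Definition eigengroup (f : {poly K}) : set endo :=
  [set s | AutPoly s /\ exists2 c : K, c != 0 & s f = c *: f].

Definition Sh (V : set K) : set endo :=
  [set s | exists2 v, V v & s = sigma 1 v].

Definition torus (nu : K) : set endo :=
  [set s | exists2 lam, lam != 0 & s = sigma lam ((1 - lam) * nu)].

(* For p the characteristic of K, a residue a : 'F_p acts on K as
   multiplication by (a : nat)%:R, the image of a in the prime field of K. *)
Definition is_Fp_subspace (p : nat) (V : set K) : Prop :=
  [/\ V 0, forall u v, V u -> V v -> V (u + v)
    & forall (a : 'F_p) v, V v -> V ((a : nat)%:R * v)].

Definition is_findim (p : nat) (V : set K) : Prop :=
  exists d (b : 'I_d -> K),
    V = [set v | exists a : 'I_d -> 'F_p, v = \sum_i (a i : nat)%:R * b i].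

Definition nonzero_findim_subspace (p : nat) (V : set K) : Prop :=
  [/\ is_Fp_subspace p V, is_findim p V & V <> [set 0]].

(* Finitely supported product: meaningful because a finite dimensional
   'F_p-subspace is a finite set (and 'X - v%:P is never 1). *)
Definition fV (V : set K) : {poly K} := \big[*%R/1]_(v \in V) ('X - v%:P).

(* The substitution f(x) |-> f(x - nu). *)
Definition shift_poly (f : {poly K}) (nu : K) : {poly K} :=
  f \Po ('X - nu%:P).

Definition is_finite_subfield (L : set K) : Prop :=
  [/\ finite_set L, L 1, forall a b, L a -> L b -> L (a - b)
    & forall a b, L a -> L b -> L (a / b)].

Definition stabilizes (L V : set K) : Prop :=
  forall a v, L a -> V v -> V (a * v).

Definition is_multiplier_field (L V : set K) : Prop :=
  [/\ is_finite_subfield L, stabilizes L V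
    & forall L', is_finite_subfield L' -> stabilizes L' V -> L' `<=` L].

(* The subgroups for which a polynomial is exhibited.  When K is infinite there
   are other subgroups (e.g. Sh K), which are not eigengroups. *)
Inductive listed (p : nat) (H : set endo) : Prop :=
| ListedTrivial of H = [set idfun]
| ListedCyclic n lam nu of
    (2 <= n)%N & n.-primitive_root lam
    & H = generated (sigma lam ((1 - lam) * nu))
| ListedSh V of nonzero_findim_subspace p V & H = Sh V
| ListedSdprod V n lam nu of
    nonzero_findim_subspace p V & (2 <= n)%N & n.-primitive_root lam
    & (forall v, V v -> V (lam * v))
    & is_sdprod H (Sh V) (generated (sigma lam ((1 - lam) * nu)))
| ListedTorus nu of H = torus nu
| ListedAut of H = AutPoly.

End Definitions.

Arguments listed {K} p H.
Arguments AutPoly K : clear implicits.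

(* Main.v *)
(* Every automorphism of K[x] is some sigma a b with a != 0, and a subgroup H is
   governed by its translations V = {v | sigma 1 v in H} and its multipliers
   A = {a | sigma a b in H for some b}, which satisfy A V <= V.  If V and A are
   finite then A is cyclic, and the fixed point nu of an element of H lying over
   a generator of A gives H = {sigma a ((1 - a) nu + u) | a in A, u in V}.  For
   an eigengroup of a nonconstant f, V is finite since f takes the same value on
   all of V, and an infinite A forces f = (x - nu)^d.
   Conversely f_V is additive with nonzero constant derivative, so that
   f_V (a x) = a f_V x as soon as a V <= V.  For g = f_V and h = g(a x + b),
   differentiating h^n + e = c (g^n + e) and multiplying by h gives
   a (c - 1) e = c g^(n-1) (h - a g), whence c = 1 and h = a g by degrees.
   Taking V = 0 here gives case 2. *)

Require Import Defs.
From HB Require Import structures.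
From mathcomp Require Import all_boot all_order all_algebra.
From mathcomp Require Import boolp classical_sets functions cardinality fsbigop.
From mathcomp Require Import cyclic.
From mathcomp Require Import ring.

Set Implicit Arguments.
Unset Strict Implicit.
Unset Printing Implicit Defensive.

Import GRing.Theory.
Local Open Scope classical_set_scope.
Local Open Scope card_scope.
Local Open Scope ring_scope.

(** * Affine substitutions and the groups they form *)

Section AffineGroups.
Variable K : fieldType.
Implicit Types (a b c d nu : K) (f g : {poly K}) (A V : set K).
Implicit Types (s t : endo K) (G H : set (endo K)).

Lemma sigmaX a b : sigma a b 'X = a *: 'X + b%:P.
Proof. exact: comp_polyX. Qed.

Lemma sigma_inj a b c d : sigma a b = sigma c d -> a = c /\ b = d.
Proof.
move=> /(congr1 (fun s : endo K => s 'X)); rewrite !sigmaX => E; split.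
  have /(congr1 (fun f : {poly K} => f`_1)) := E.
  by rewrite !coefE /= !mulr1 !addr0.
have /(congr1 (fun f : {poly K} => f`_0)) := E.
by rewrite !coefE /= !mulr0 !add0r.
Qed.

Lemma sigma_id : sigma 1 0 = idfun :> endo K.
Proof. by apply/funext => f; rewrite /sigma scale1r addr0 comp_polyXr. Qed.

(** The left factor acts by substituting into the image of ['X] under the right one:
    [c (a x + b) + d]. Hence the constant term [c * b + d]. *)
Lemma sigma_comp a b c d :
  sigma a b \o sigma c d = sigma (a * c) (c * b + d).
Proof.
apply/funext => f; rewrite /sigma /= -comp_polyA; congr (_ \Po _).
rewrite comp_polyD comp_polyZ comp_polyX comp_polyC -!mul_polyC; ring.
Qed.

Lemma sigmaK a b : a != 0 -> cancel (sigma a b) (sigma a^-1 (- (a^-1 * b))).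
Proof.
move=> a0 f; rewrite -[LHS]/((sigma _ _ \o sigma _ _) f) sigma_comp.
by rewrite mulVf // mulrN mulVKf // addrC subrr sigma_id.
Qed.

Lemma sigmaVK a b : a != 0 -> cancel (sigma a^-1 (- (a^-1 * b))) (sigma a b).
Proof.
move=> a0 f; rewrite -[LHS]/((sigma _ _ \o sigma _ _) f) sigma_comp.
by rewrite mulfV // subrr sigma_id.
Qed.

(** An algebra endomorphism is substitution of the image of ['X]. Degrees multiply under
    composition, so invertibility forces that image to have degree 1. *)
Lemma AutPolyP s :
  AutPoly K s <-> exists a b, a != 0 /\ s = sigma a b.
Proof.
split=> [[sl sm sb]|[a [b [a0 ->]]]]; last first.
  split.
  - by move=> c f g; rewrite /sigma comp_polyD comp_polyZ.
  - by split=> [|f g]; rewrite /sigma ?comp_polyM // comp_polyC.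
  - by exists (sigma a^-1 (- (a^-1 * b))); [exact: sigmaK|exact: sigmaVK].
have [s1 sM] := sm.
have s0 : s 0 = 0 by have := sl (-1) 0 0; rewrite /= !scaleN1r addr0 oppr0 addNr.
have sZ c f : s (c *: f) = c *: s f by have := sl c f 0; rewrite !addr0 s0 addr0.
have sD f g : s (f + g) = s f + s g by have := sl 1 f g; rewrite !scale1r.
have sE f : s f = f \Po s 'X.
  elim/poly_ind: f => [|f c IH]; first by rewrite comp_poly0 s0.
  rewrite sD sM IH -[c%:P]mulr1 mul_polyC sZ s1 comp_polyD comp_polyM comp_polyX.
  by rewrite comp_polyZ comp_polyC.
case: sb => t tK sK.
have sz : size (s 'X) = 2%N.
  have := size_comp_poly (t 'X) (s 'X); rewrite -sE sK size_polyX /=.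
  by move/esym/eqP; rewrite muln_eq1 => /andP[_]; case: (size _) => [//|[|[]]].
exists (s 'X)`_1, (s 'X)`_0; split.
  have: lead_coef (s 'X) != 0 by rewrite lead_coef_eq0 -size_poly_eq0 sz.
  by rewrite lead_coefE sz.
apply/funext => f; rewrite sE /sigma; congr (_ \Po _).
apply/polyP => i; rewrite !coefE; case: i => [|[|i]]; rewrite //=.
- by rewrite mulr0 add0r.
- by rewrite mulr1 addr0.
- by rewrite mulr0 addr0 nth_default // sz.
Qed.

Lemma sigma_aut a b : a != 0 -> AutPoly K (sigma a b).
Proof. by move=> a0; apply/AutPolyP; exists a, b. Qed.

Lemma sigma_aut_neq0 a b : AutPoly K (sigma a b) -> a != 0.
Proof. by move=> /AutPolyP[c [d [c0 /sigma_inj[-> _]]]]. Qed.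

Lemma eq_aut_set G H : G `<=` AutPoly K -> H `<=` AutPoly K ->
  (forall a b, a != 0 -> G (sigma a b) <-> H (sigma a b)) -> G = H.
Proof.
move=> sG sH GH; apply/seteqP; split=> s Hs.
  by have /AutPolyP[a [b [a0 E]]] := sG _ Hs; rewrite E in Hs *; exact/GH.
by have /AutPolyP[a [b [a0 E]]] := sH _ Hs; rewrite E in Hs *; exact/GH.
Qed.

Lemma subgroupV H a b : is_subgroup H -> a != 0 -> H (sigma a b) ->
  H (sigma a^-1 (- (a^-1 * b))).
Proof.
move=> [_ _ _ HV] a0 /HV[t [Ht _ tK]].
suff <- : t = sigma a^-1 (- (a^-1 * b)) by [].
apply/funext => f; rewrite -[in RHS](tK f); apply/esym/sigmaK => //.
Qed.

Definition add_subgroup V :=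
  [/\ V 0, forall u v, V u -> V v -> V (u + v) & forall u, V u -> V (- u)].

Definition mul_subgroup A :=
  [/\ A `<=` [set a | a != 0], A 1, forall a b, A a -> A b -> A (a * b)
    & forall a, A a -> A a^-1].

(** For [u = 0] the element sends [x - nu] to [a (x - nu)], so [nu] is the common fixed point.
    Trivial, cyclic, translation, semidirect and torus groups are all instances. *)
Definition affine A nu V : set (endo K) :=
  [set s | exists a u, [/\ A a, V u & s = sigma a ((1 - a) * nu + u)]].

Lemma affineP A nu V a b :
  affine A nu V (sigma a b) <-> A a /\ V (b - (1 - a) * nu).
Proof.
split=> [[c [u [Ac Vu /sigma_inj[-> ->]]]]|[Aa Vb]].
  by rewrite addrAC subrr add0r.
by exists a, (b - (1 - a) * nu); split=> //; rewrite addrC subrK.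
Qed.

Lemma affine_aut A nu V : A `<=` [set a | a != 0] -> affine A nu V `<=` AutPoly K.
Proof. by move=> A0 s [a [u [Aa _ ->]]]; apply: sigma_aut; exact: A0. Qed.

Lemma affine_subgroup A nu V : mul_subgroup A -> add_subgroup V ->
  (forall a v, A a -> V v -> V (a * v)) -> is_subgroup (affine A nu V).
Proof.
move=> [A0 A1 AM AV] [V0 VD VN] AVV; split.
- exact: affine_aut.
- by rewrite -sigma_id; apply/affineP; rewrite subrr mul0r subrr.
- move=> _ _ [a [u [Aa Vu ->]]] [c [v [Ac Vv ->]]]; rewrite sigma_comp.
  apply/affineP; split; first exact: AM.
  have -> : c * ((1 - a) * nu + u) + ((1 - c) * nu + v) - (1 - a * c) * nu
    = c * u + v by ring.
  by apply: VD => //; exact: AVV.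
- move=> _ [a [u [Aa Vu ->]]]; have a0 := A0 _ Aa.
  exists (sigma a^-1 (- (a^-1 * ((1 - a) * nu + u)))); split.
  + apply/affineP; split; first exact: AV.
    have -> : - (a^-1 * ((1 - a) * nu + u)) - (1 - a^-1) * nu = - (a^-1 * u) by field.
    by apply: VN; apply: AVV => //; exact: AV.
  + exact: sigmaK.
  + exact: sigmaVK.
Qed.

Lemma add_subgroup0 : add_subgroup [set 0].
Proof. by split=> [//|u v -> ->|u ->] /=; rewrite ?addr0 ?oppr0. Qed.

Lemma mul_subgroup1 : mul_subgroup [set 1].
Proof.
by split=> [_ ->|//|a b -> ->|a ->] /=; rewrite ?oner_eq0 ?mulr1 ?invr1.
Qed.

Definition unity_roots n : set K := [set a | a ^+ n = 1].

Lemma unity_root_neq0 n a : (0 < n)%N -> a ^+ n = 1 -> a != 0.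
Proof.
move=> n0 an; apply/eqP => a0; move/eqP: an.
by rewrite a0 expr0n gtn_eqF //= eq_sym oner_eq0.
Qed.

Lemma mul_subgroup_unity_roots n : (0 < n)%N -> mul_subgroup (unity_roots n).
Proof.
move=> n0; split; rewrite /unity_roots /=.
- by move=> a; exact: unity_root_neq0.
- by rewrite expr1n.
- by move=> a b an bn; rewrite exprMn an bn mulr1.
- by move=> a an; rewrite exprVn an invr1.
Qed.

Lemma affine_trivial nu : affine [set 1] nu [set 0] = [set idfun].
Proof.
apply/seteqP; split=> [_ [a [u [-> -> ->]]] | _ ->] /=.
  by rewrite subrr mul0r addr0 sigma_id.
by exists 1, 0; split=> //; rewrite subrr mul0r addr0 sigma_id.
Qed.

Lemma affine_Sh nu V : affine [set 1] nu V = Sh V.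
Proof.
apply/seteqP; split=> [_ [a [u [-> Vu ->]]] | _ [u Vu ->]].
  by exists u => //; rewrite subrr mul0r add0r.
by exists 1, u; split=> //; rewrite subrr mul0r add0r.
Qed.

Lemma affine_torus nu : affine [set a | a != 0] nu [set 0] = torus nu.
Proof.
apply/seteqP; split=> [_ [a [u [a0 -> ->]]] | _ [a a0 ->]].
  by exists a => //; rewrite addr0.
by exists a, 0; split=> //; rewrite addr0.
Qed.

Lemma subgroup_sigmaX H a nu k : is_subgroup H ->
  H (sigma a ((1 - a) * nu)) -> H (sigma (a ^+ k) ((1 - a ^+ k) * nu)).
Proof.
move=> [_ H1 HM _] Ha; elim: k => [|k IH].
  by rewrite expr0 subrr mul0r sigma_id.
have := HM _ _ Ha IH; rewrite sigma_comp -exprS.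
by congr (H (sigma _ _)); rewrite exprS; ring.
Qed.

(** Every [n]-th root of unity is a power of [lam], so a subgroup containing the generator contains
    the left-hand side, which is itself such a subgroup. *)
Lemma affine_generated n lam nu : n.-primitive_root lam ->
  affine (unity_roots n) nu [set 0] = generated (sigma lam ((1 - lam) * nu)).
Proof.
move=> lamn; have n0 := prim_order_gt0 lamn.
apply/seteqP; split=> [s [a [u [an -> ->]]] H Hgrp Hlam | s].
  have [i ->] := prim_rootP lamn an; rewrite addr0.
  exact: subgroup_sigmaX.
apply.
  apply: affine_subgroup (mul_subgroup_unity_roots n0) add_subgroup0 _.
  by move=> a v _ ->; rewrite /= mulr0.
by apply/affineP; split; [exact: prim_expr_order|rewrite subrr].
Qed.

Lemma unity_roots_stab n lam V a v : n.-primitive_root lam ->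
  (forall v, V v -> V (lam * v)) -> a ^+ n = 1 -> V v -> V (a * v).
Proof.
move=> lamn Vlam an Vv; have [i ->] := prim_rootP lamn an.
elim: (i : nat) => [|k IH]; first by rewrite mul1r.
by rewrite exprS -mulrA; exact: Vlam.
Qed.

Lemma affine_sdprod n lam nu V : n.-primitive_root lam -> add_subgroup V ->
  (forall v, V v -> V (lam * v)) ->
  is_sdprod (affine (unity_roots n) nu V) (Sh V)
    (generated (sigma lam ((1 - lam) * nu))).
Proof.
move=> lamn Vgrp Vlam; have n0 := prim_order_gt0 lamn.
have Agrp := mul_subgroup_unity_roots n0; have [A0 A1 AM AV] := Agrp.
have [V0 VD VN] := Vgrp.
have AVV a v : unity_roots n a -> V v -> V (a * v).
  exact: unity_roots_stab Vlam.
(* With both factors written as [affine] groups over the same [nu], each clause becomes a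
   computation on coefficients. *)
rewrite -(affine_generated nu lamn) -(affine_Sh nu).
have G := affine_subgroup nu Agrp Vgrp AVV; split=> //.
- split=> //; split.
    by move=> _ [_ [u [-> Vu ->]]]; exists 1, u.
  move=> g h _ Gg gK hK [_ [u [-> Vu ->]]].
  case: Gg => [a [v [Aa Vv gE]]]; rewrite {g}gE in gK hK *.
  have a0 := A0 _ Aa.
  have -> : h = sigma a^-1 (- (a^-1 * ((1 - a) * nu + v))).
    by apply/funext => f; rewrite -[in RHS](hK f) sigmaK.
  rewrite !sigma_comp; apply/affineP; split; first by rewrite /= mulr1 mulfV.
  (* Conjugation rescales the translation by [a^-1]. *)
  set w := (X in V X); have -> : w = a^-1 * u by rewrite /w; field.
  by apply: AVV => //; exact: AV.
- apply: affine_subgroup mul_subgroup1 Vgrp _.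
  by move=> a v ->; rewrite mul1r.
- apply: affine_subgroup Agrp add_subgroup0 _.
  by move=> a v _ ->; rewrite /= mulr0.
- apply/seteqP; split=> [s [[_ [u [-> Vu ->]]] /affineP[_ /=]] | _ ->].
    by rewrite subrr mul0r add0r subr0 => ->; exact: sigma_id.
  rewrite -sigma_id; split; apply/affineP; split=> //;
    by rewrite /= subrr mul0r subr0.
- apply/seteqP; split=> [_ [a [u [Aa Vu ->]]] | s [m [c []]]].
    (* Composition multiplies the left constant term by the right multiplier [a], so [u] is divided
       by [a] beforehand. *)
    exists (sigma 1 (a^-1 * u)), (sigma a ((1 - a) * nu)); split.
    + apply/affineP; split=> //; rewrite subrr mul0r subr0.
      by apply: AVV => //; exact: AV.
    + by apply/affineP; rewrite subrr.
    + rewrite sigma_comp mul1r mulVKf 1?addrC //; exact: A0.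
  move=> [_ [u [-> Vu ->]]] [a [_ [Aa -> ->]]] ->.
  rewrite sigma_comp; apply/affineP.
  rewrite mul1r; split=> //; set w := (X in V X).
  by have -> : w = a * u by [rewrite /w; ring]; exact: AVV.
Qed.

(** * Degrees, leading coefficients and values under affine substitution *)

Lemma size_sub_lead f g n : size f = n.+1 -> size g = n.+1 ->
  lead_coef f = lead_coef g -> (size (f - g)%R <= n)%N.
Proof.
move=> s1 s2; rewrite !lead_coefE s1 s2 /= => E; apply/leq_sizeP => j.
rewrite leq_eqVlt coefB => /predU1P[<-|ltnj]; first by rewrite E subrr.
by rewrite !nth_default ?subrr // ?s1 ?s2.
Qed.

Lemma size_affine a b : a != 0 -> size (a *: 'X + b%:P) = 2%N.
Proof.
move=> a0; rewrite size_polyDl size_scale ?size_polyX //.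
by rewrite (leq_ltn_trans (size_polyC_leq1 _)).
Qed.

Lemma lead_coef_comp_affine f a b : a != 0 ->
  lead_coef (f \Po (a *: 'X + b%:P)) = lead_coef f * a ^+ (size f).-1.
Proof.
move=> a0; rewrite lead_coef_comp ?size_affine // lead_coefDl; last first.
  by rewrite size_scale // size_polyX (leq_ltn_trans (size_polyC_leq1 _)).
by rewrite lead_coefZ lead_coefX mulr1.
Qed.

Lemma size_comp_affine f a b : a != 0 -> size (f \Po (a *: 'X + b%:P)) = size f.
Proof. by move=> a0; rewrite size_comp_poly2 ?size_affine. Qed.

Lemma horner_comp_affine f a b x : (f \Po (a *: 'X + b%:P)).[x] = f.[a * x + b].
Proof. by rewrite horner_comp !hornerE. Qed.

Lemma eigengroupP f a b : eigengroup f (sigma a b) <->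
  a != 0 /\ exists2 c : K, c != 0 & f \Po (a *: 'X + b%:P) = c *: f.
Proof.
by split=> -[H1 H2]; split=> //; [exact: sigma_aut_neq0 H1|exact: sigma_aut].
Qed.

End AffineGroups.

(** * The additive polynomial of a finite group [V] and eigengroups derived from it *)

Section AdditivePolynomial.
Variables (K : fieldType) (V : set K).
Hypotheses (Vgrp : add_subgroup V) (Vfin : finite_set V).
Implicit Types (a b c e nu rho : K) (f : {poly K}).
(** [r] lists [V] without repetition, so [q] is both the order of [V] and the degree of [fV V]. *)
Let r : seq K := finmap.enum_fset (fset_set V).
Let q := size r.

Lemma mem_fset_setP x : x \in r <-> V x.
Proof. by have := in_fset_set Vfin x; rewrite /r => ->; rewrite inE. Qed.

Lemma fVE : fV V = \prod_(v <- r) ('X - v%:P).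
Proof. exact: fsbig_finite. Qed.

Lemma fV_monic : fV V \is monic.
Proof. by rewrite fVE monic_prod_XsubC. Qed.

Lemma size_fV : size (fV V) = q.+1.
Proof. by rewrite fVE size_prod_XsubC. Qed.

Lemma root_fV x : (fV V).[x] = 0 <-> V x.
Proof.
rewrite -mem_fset_setP -root_prod_XsubC -fVE; split=> [/eqP //|].
by rewrite /root => /eqP.
Qed.

Lemma fV_eq0 x : V x -> (fV V).[x] = 0.
Proof. by move/root_fV. Qed.

Lemma fV_card_gt0 : (0 < q)%N.
Proof.
have [V0 _ _] := Vgrp; move/mem_fset_setP: V0; rewrite /q.
by case: r.
Qed.

(** A difference of degree below [q] with [q] roots is zero. Polynomials of degree [q] with equal
    leading coefficients thus need comparing only on [V]. *)
Lemma poly_eq_on_V f1 f2 : (size (f1 - f2)%R <= q)%N ->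
  (forall v, V v -> f1.[v] = f2.[v]) -> f1 = f2.
Proof.
move=> sz E; apply/eqP; rewrite -subr_eq0; apply/eqP.
apply: (roots_geq_poly_eq0 (rs := r)) sz; last exact: finmap.fset_uniq.
by apply/allP => v /mem_fset_setP Vv; rewrite /root !hornerE E // subrr.
Qed.

(** Translation by [v] maps [V] to itself, so both sides are monic of degree [q] and vanish on
    [V]. *)
Lemma fV_periodic v : V v -> fV V \Po ('X + v%:P) = fV V.
Proof.
move=> Vv; have [V0 VD VN] := Vgrp; rewrite -['X]scale1r; apply: poly_eq_on_V.
  apply: size_sub_lead; rewrite ?size_comp_affine ?oner_eq0 ?size_fV //.
  by rewrite lead_coef_comp_affine ?oner_eq0 // expr1n mulr1.
move=> w Vw; rewrite horner_comp_affine mul1r.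
by rewrite !fV_eq0 //; exact: VD.
Qed.

(** For fixed [b] both sides are monic polynomials of degree [q] in [a], and periodicity makes them
    agree on [V]. *)
Lemma fV_hornerD a b : (fV V).[a + b] = (fV V).[a] + (fV V).[b].
Proof.
suff E : fV V \Po (1 *: 'X + b%:P) = fV V + ((fV V).[b])%:P.
  by have := congr1 (horner^~ a) E; rewrite /= horner_comp_affine mul1r !hornerE.
have sC : (size ((fV V).[b])%:P < size (fV V))%N.
  by rewrite size_fV ltnS (leq_trans (size_polyC_leq1 _)) ?fV_card_gt0.
apply: poly_eq_on_V.
  apply: size_sub_lead.
  - by rewrite size_comp_affine ?oner_eq0 // size_fV.
  - by rewrite size_polyDl // size_fV.
  - by rewrite lead_coef_comp_affine ?oner_eq0 // expr1n mulr1 lead_coefDl.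
move=> v Vv; rewrite horner_comp_affine mul1r !hornerE.
rewrite (fV_eq0 Vv) add0r.
by have := congr1 (horner^~ b) (fV_periodic Vv); rewrite /= horner_comp !hornerE addrC.
Qed.

Lemma fV_horner0 : (fV V).[0] = 0.
Proof. by have [V0 _ _] := Vgrp; exact/root_fV. Qed.

Lemma fV_hornerN a : (fV V).[- a] = - (fV V).[a].
Proof. by apply/eqP; rewrite -addr_eq0 -fV_hornerD addNr fV_horner0. Qed.

(** Differentiating the periodicity relation shows that the derivative, of degree below [q], has on
    all of [V] its value at 0. *)
Lemma deriv_fV : (fV V)^`() = ((fV V)`_1)%:P.
Proof.
have g0 : (fV V)^`().[0] = (fV V)`_1 by rewrite horner_coef0 coef_deriv.
apply: poly_eq_on_V => [|v Vv].
  rewrite (leq_trans (size_polyD _ _)) // geq_max size_polyN.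
  rewrite (leq_trans (size_polyC_leq1 _)) ?fV_card_gt0 // andbT.
  by rewrite -ltnS -size_fV lt_size_deriv // -size_poly_eq0 size_fV.
have := congr1 (fun f => f^`().[0]) (fV_periodic Vv).
by rewrite deriv_comp !derivE addr0 mulr1 horner_comp !hornerE g0.
Qed.

(** Splitting off the factor ['X] leaves the value at 0 of the product over the nonzero elements of
    [V]. *)
Lemma fV_coef1_neq0 : (fV V)`_1 != 0.
Proof.
have [V0 _ _] := Vgrp; move/mem_fset_setP : V0 => r0.
rewrite fVE (perm_big _ (perm_to_rem r0)) big_cons subr0 coefXM /=.
rewrite -horner_coef0 -/(root _ 0) root_prod_XsubC.
by rewrite mem_rem_uniq ?inE ?eqxx //; exact: finmap.fset_uniq.
Qed.

(** Comparison on [V] first gives the scalar [a ^+ q]. Comparing the constant derivatives of both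
    sides then gives [a ^+ q = a]. *)
Lemma fV_comp_affine a b : a != 0 -> (forall v, V v -> V (a * v)) ->
  fV V \Po (a *: 'X + b%:P) = a *: fV V + ((fV V).[b])%:P.
Proof.
move=> a0 Va; have [V0 VD VN] := Vgrp.
have E : fV V \Po (a *: 'X + b%:P) = a ^+ q *: fV V + ((fV V).[b])%:P.
  have sC : (size ((fV V).[b])%:P < size (a ^+ q *: fV V))%N.
    rewrite size_scale ?expf_neq0 // size_fV ltnS.
    by rewrite (leq_trans (size_polyC_leq1 _)) ?fV_card_gt0.
  apply: poly_eq_on_V.
    apply: size_sub_lead.
    - by rewrite size_comp_affine // size_fV.
    - by rewrite size_polyDl // size_scale ?expf_neq0 // size_fV.
    - by rewrite lead_coef_comp_affine // size_fV lead_coefDl // lead_coefZ mulrC.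
  move=> v Vv; rewrite horner_comp_affine fV_hornerD !hornerE.
  by rewrite (fV_eq0 Vv) (fV_eq0 (Va _ Vv)) mulr0.
suff aq : a ^+ q = a by rewrite E aq.
have /(congr1 (fun f : {poly K} => (f^`())`_0)) := E.
rewrite deriv_comp !derivE deriv_fV comp_polyC !coefE /= mulr1 !addr0 mulrC.
by move/(mulIf fV_coef1_neq0).
Qed.

Lemma fV_hornerM a x : a != 0 -> (forall v, V v -> V (a * v)) ->
  (fV V).[a * x] = a * (fV V).[x].
Proof.
move=> a0 Va; have := congr1 (horner^~ x) (fV_comp_affine 0 a0 Va).
by rewrite /= horner_comp_affine fV_horner0 !addr0 hornerZ.
Qed.

(** Leading coefficients in [fV_comp_affine]. For [V = K] this is Fermat's identity in a finite
    field. *)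
Lemma card_root_stab a : a != 0 -> (forall v, V v -> V (a * v)) -> a ^+ q = a.
Proof.
move=> a0 Va; have := lead_coef_comp_affine (fV V) 0 a0.
rewrite fV_comp_affine // fV_horner0 addr0 lead_coefZ size_fV (monicP fV_monic).
by rewrite mulr1 mul1r.
Qed.

Lemma eigengroup_fV a b : eigengroup (fV V) (sigma a b) <->
  [/\ a != 0, forall v, V v -> V (a * v) & V b].
Proof.
have [V0 VD VN] := Vgrp; split=> [/eigengroupP[a0 [c c0 E]]|[a0 Va Vb]].
  have Vab v : V v -> V (a * v + b).
    move=> /root_fV gv; apply/root_fV.
    by rewrite -horner_comp_affine E hornerZ gv mulr0.
  have Vb : V b by have := Vab 0 V0; rewrite mulr0 add0r.
  by split=> // v Vv; rewrite -[_ * _](addrK b); apply: VD; auto.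
apply/eigengroupP; split=> //; exists a => //.
by rewrite fV_comp_affine // (fV_eq0 Vb) addr0.
Qed.

Lemma size_fVX n : size (fV V ^+ n) = (q * n).+1.
Proof.
elim: n => [|n IH]; first by rewrite expr0 size_poly1 muln0.
rewrite exprS size_monicM ?fV_monic ?monic_neq0 ?monic_exp ?fV_monic //.
by rewrite IH size_fV mulnS addSn addnS.
Qed.

Lemma eigengroup_fVX n e a b : (2 <= n)%N -> n%:R != 0 :> K -> e != 0 ->
  eigengroup (fV V ^+ n + e%:P) (sigma a b) <->
  [/\ a ^+ n = 1, forall v, V v -> V (a * v) & V b].
Proof.
move=> n2 nK e0; have n0 : (0 < n)%N by case: n n2 {nK}.
split=> [/eigengroupP[a0 [c c0 E]]|[an Va Vb]]; last first.
  have a0 := unity_root_neq0 n0 an.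
  apply/eigengroupP; split=> //; exists 1; rewrite ?oner_eq0 // scale1r.
  rewrite comp_polyD rmorphXn /= comp_polyC fV_comp_affine //.
  by rewrite (fV_eq0 Vb) addr0 exprZn an scale1r.
set g := fV V in E *; pose h := g \Po (a *: 'X + b%:P).
have Eh : h ^+ n + e%:P = c%:P * (g ^+ n + e%:P).
  by rewrite mul_polyC -E comp_polyD rmorphXn /= comp_polyC.
have dh : h^`() = (g`_1)%:P * a%:P.
  by rewrite deriv_comp deriv_fV comp_polyC !derivE alg_polyC addr0.
(* Derivative of [Eh]: [g] and [h] have constant derivatives, and the common factor [n * g_1] is
   nonzero. *)
have Ed : a%:P * h ^+ n.-1 = c%:P * g ^+ n.-1.
  have /(congr1 (@deriv K)) := Eh.
  rewrite derivM !derivE mul0r add0r !addr0 !deriv_exp dh deriv_fV -/g.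
  move=> H.
  have nz : n%:R * (g`_1)%:P != 0 :> {poly K}.
    by rewrite mulf_neq0 ?polyC_eq0 ?fV_coef1_neq0 // -polyC_natr polyC_eq0.
  apply: (mulfI nz).
  transitivity (n%:R * ((g`_1)%:P * a%:P * h ^+ n.-1)); first by ring.
  rewrite mulr_natl H -mulr_natl -[in RHS]mulr_natl.
  ring.
(* Multiply [Ed] by [h] and eliminate [h ^+ n] by [Eh]. *)
have Ec : c%:P * g ^+ n.-1 * (h - a%:P * g) = (a * (c - 1) * e)%:P.
  have -> : c%:P * g ^+ n.-1 * (h - a%:P * g)
      = a%:P * h ^+ n.-1 * h - a%:P * (c%:P * (g ^+ n.-1 * g)) by rewrite Ed; ring.
  rewrite -mulrA -!exprSr prednK //.
  have -> : h ^+ n = c%:P * (g ^+ n + e%:P) - e%:P by rewrite -Eh addrK.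
  ring.
(* Otherwise [g ^+ n.-1], of degree [q (n - 1) > 0] as [n >= 2], would divide a nonzero constant. *)
have c1 : c = 1.
  apply/eqP/contraT => c1; have := congr1 (fun f : {poly K} => size f) Ec.
  have nz : a * (c - 1) * e != 0 by rewrite !mulf_neq0 // subr_eq0.
  rewrite size_polyC nz => sz1.
  have dvd : g ^+ n.-1 %| (a * (c - 1) * e)%:P by rewrite -Ec mulrAC dvdp_mull.
  have := dvdp_leq _ dvd; rewrite polyC_eq0 => /(_ nz).
  rewrite size_fVX size_polyC nz ltnS leqn0 muln_eq0 eqn0Ngt fV_card_gt0 /=.
  by case: (n) n2 => [|[]].
have Eg : h = a *: g.
  have := Ec; rewrite c1 subrr mulr0 mul0r => /eqP; rewrite mulf_eq0 subr_eq0.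
  rewrite mul1r expf_eq0 -size_poly_eq0 size_fV andbF /= => /eqP ->.
  by rewrite mul_polyC.
(* [h = a *: g] puts [sigma a b] in the eigengroup of [g] itself; [a ^+ n = 1] is then read off
   leading coefficients. *)
have [_ Va Vb] : [/\ a != 0, forall v, V v -> V (a * v) & V b].
  by apply/eigengroup_fV/eigengroupP; split=> //; exists a.
split=> //; have := Eh; rewrite c1 mul1r Eg => /addIr; rewrite exprZn.
move/(congr1 lead_coef); rewrite lead_coefZ.
by rewrite (monicP _) ?monic_exp ?fV_monic // mulr1.
Qed.

(** If [a != 1], the fixed point [b / (1 - a)] of the substitution would be a point where [fV V]
    takes the omitted value [rho]. *)
Lemma eigengroup_fV_sub rho a b : (forall x, (fV V).[x] != rho) ->
  eigengroup (fV V - rho%:P) (sigma a b) <-> a = 1 /\ V b.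
Proof.
move=> Nrho; split=> [/eigengroupP[a0 [c c0 E]]|[-> Vb]]; last first.
  apply/eigengroupP; split; [exact: oner_neq0|exists 1; first exact: oner_neq0].
  by rewrite !scale1r comp_polyB comp_polyC fV_periodic.
have Ex x : (fV V).[a * x] + (fV V).[b] - rho = c * ((fV V).[x] - rho).
  have := congr1 (horner^~ x) E.
  by rewrite /= horner_comp_affine !hornerE fV_hornerD.
(* The derivatives of the two sides are [a] and [c] times the same nonzero constant. *)
have ca : c = a.
  have /(congr1 (fun f : {poly K} => (f^`())`_0)) := E.
  rewrite deriv_comp !derivE !deriv_fV oppr0 addr0 comp_polyC !coefE /= mulr1.
  by rewrite !addr0 mulrC => /(mulIf fV_coef1_neq0).
rewrite {c c0 E}ca in Ex.
have Eb : (fV V).[b] = (1 - a) * rho.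
  have := Ex 0; rewrite mulr0 fV_horner0 => /(canRL (subrK _)).
  by rewrite add0r => ->; ring.
have Ea x : (fV V).[a * x] = a * (fV V).[x].
  by have := Ex x; rewrite Eb => /(canRL (subrK _))/(canRL (addrK _)) ->; ring.
have a1 : a = 1.
  apply/eqP/contraT => a1; have na1 : 1 - a != 0 by rewrite subr_eq0 eq_sym.
  have /negP[] := Nrho (b / (1 - a)).
  rewrite -(inj_eq (mulfI na1)) -Eb mulrBl mul1r -Ea -fV_hornerN -fV_hornerD.
  by apply/eqP; congr (_.[_]); field.
by split=> //; apply/root_fV; rewrite Eb a1 subrr mul0r.
Qed.

Lemma shift_fV nu : shift_poly (fV V) nu = fV V - ((fV V).[nu])%:P.
Proof.
rewrite /shift_poly -['X]scale1r -polyCN fV_comp_affine ?oner_neq0 //.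
  by rewrite fV_hornerN scale1r polyCN.
by move=> v; rewrite mul1r.
Qed.

(* [fV V] has constant derivative, so the derivative of the polynomial below
   separates its simple roots [V] from its double roots [nu + V]. *)
Lemma eigengroup_fV_shift nu a b : ~ V nu ->
  eigengroup (fV V * shift_poly (fV V) nu ^+ 2) (sigma a b) <-> a = 1 /\ V b.
Proof.
move=> Vnu; have [V0 VD VN] := Vgrp; rewrite shift_fV.
set r0 := (fV V).[nu].
have r0N : r0 != 0 by apply/eqP => /root_fV.
split=> [/eigengroupP[a0 [c c0 E]]|[-> Vb]]; last first.
  apply/eigengroupP; split; [exact: oner_neq0|exists 1; first exact: oner_neq0].
  by rewrite !scale1r comp_polyM rmorphXn /= comp_polyB comp_polyC fV_periodic.
have E0 x : (fV V).[a * x + b] * ((fV V).[a * x + b] - r0) ^+ 2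
    = c * ((fV V).[x] * ((fV V).[x] - r0) ^+ 2).
  by have := congr1 (horner^~ x) E; rewrite /= horner_comp_affine !hornerE.
(* The derivative at [y] divided by the constant derivative of [fV V]: it equals [r0 ^+ 2] on [V]
   and 0 on [nu + V]. *)
pose d y := ((fV V).[y] - r0) ^+ 2 + (fV V).[y] * ((fV V).[y] - r0) *+ 2.
have E1 x : a * d (a * x + b) = c * d x.
  apply: (mulfI fV_coef1_neq0).
  have /(congr1 (fun f : {poly K} => f^`().[x])) := E.
  rewrite deriv_comp derivM deriv_exp !derivE !deriv_fV !oppr0 !addr0.
  rewrite !hornerE horner_comp_affine !hornerE /d /= => H.
  by apply: etrans (etrans _ H) _; ring.
have Vab v : V v -> V (a * v + b).
  move=> Vv; have := E0 v; rewrite (fV_eq0 Vv) mul0r mulr0 => /eqP.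
  rewrite mulf_eq0 expf_eq0 /= subr_eq0 => /orP[/eqP/root_fV //|/eqP gr].
  have := E1 v; rewrite /d gr subrr expr0n mulr0 mul0rn addr0 mulr0 (fV_eq0 Vv).
  rewrite mul0r mul0rn addr0 sub0r sqrrN => /esym/eqP.
  by rewrite !mulf_eq0 (negPf c0) (negPf r0N).
have Vb : V b by have := Vab 0 V0; rewrite mulr0 add0r.
have Va v : V v -> V (a * v) by move=> Vv; rewrite -[_ * _](addrK b); auto.
(* It remains to see that [fV V] takes the value [r0] at [a * nu]: the double root [nu] goes to a
   root, and not to a simple one. *)
split=> //; apply: (mulIf r0N); rewrite mul1r -fV_hornerM //.
have := E0 nu; rewrite -/r0 subrr expr0n !mulr0 fV_hornerD (fV_eq0 Vb) addr0 => /eqP.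
rewrite mulf_eq0 expf_eq0 /= subr_eq0 => /orP[/eqP g0|/eqP //].
have := E1 nu; rewrite /d fV_hornerD (fV_eq0 Vb) addr0 g0 -/r0 subrr expr0n.
rewrite mul0r mulr0 mul0rn !addr0 mulr0 sub0r sqrrN => /eqP.
by rewrite !mulf_eq0 (negPf a0) (negPf r0N).
Qed.

End AdditivePolynomial.

(** * Subgroups with finitely many translations and multipliers *)

Section Structure.
Variables (K : fieldType) (p : nat).
Hypothesis charKp : p \in [pchar K].
Implicit Types (a b c nu : K) (f : {poly K}) (A V : set K) (H : set (endo K)).

(** Prime field scalars act by repeated addition, and [- v] is [v *+ p.-1]. *)
Lemma Fp_subspaceP V : is_Fp_subspace p V <-> add_subgroup V.
Proof.
split=> [[V0 VD _]|[V0 VD VN]]; last first.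
  split=> // a v Vv; rewrite mulr_natl.
  by elim: (a : nat) => [|k IH]; rewrite ?mulr0n // mulrS; exact: VD.
split=> // v Vv.
have -> : - v = v *+ p.-1.
  apply/eqP; rewrite eq_sym -addr_eq0 -mulrSr prednK ?(mulrn_pchar charKp) //.
  exact: prime_gt0 (pcharf_prime charKp).
by elim: (p.-1) => [|k IH]; rewrite ?mulr0n // mulrS; exact: VD.
Qed.

Lemma findim_finite V : is_findim p V -> finite_set V.
Proof.
move=> [d [b ->]].
apply: (@sub_finite_set _ _
  ((fun a : {ffun 'I_d -> 'F_p} => \sum_i (a i : nat)%:R * b i) @` setT)).
  move=> _ [a ->]; exists (finfun a) => //.
  by apply: eq_bigr => i _; rewrite ffunE.
exact/finite_image/finite_finset.
Qed.

Lemma add_subgroup_sum V d (F : 'I_d -> K) :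
  add_subgroup V -> (forall i, V (F i)) -> V (\sum_i F i).
Proof. by move=> [V0 VD _] VF; apply: (big_ind V). Qed.

Lemma finite_findim V : add_subgroup V -> finite_set V -> is_findim p V.
Proof.
move=> Vgrp Vfin; have [V0 VD VN] := Vgrp.
have [r Vr] := (finite_seqP V).1 Vfin.
have memr v : v \in r <-> V v by rewrite Vr.
(* All elements of [V] together serve as spanning family. *)
exists (size r), (fun i => r`_i); apply/seteqP; split=> [v /memr vr | _ [a ->]].
  have ri : (index v r < size r)%N by rewrite index_mem.
  exists (fun i => (i == Ordinal ri)%:R).
  rewrite (bigD1 (Ordinal ri)) //= eqxx nth_index // big1 ?addr0 ?mul1r // => i.
  by move=> /negPf ->; rewrite mul0r.
have [_ _ VS] := (Fp_subspaceP V).2 Vgrp.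
apply: add_subgroup_sum => // i; apply: VS; apply/memr; exact: mem_nth.
Qed.

Lemma nonzero_findimP V : nonzero_findim_subspace p V <->
  [/\ add_subgroup V, finite_set V & V <> [set 0]].
Proof.
split=> [[/Fp_subspaceP Vgrp /findim_finite Vfin V0]|[Vgrp Vfin V0]]; split=> //.
  exact/Fp_subspaceP.
exact: finite_findim.
Qed.

(** Multiplication by [a] permutes [A]; comparing the products over [A] gives [a ^+ n = 1]. Having
    [n] distinct [n]-th roots of unity, [A] contains a primitive one. *)
Lemma mul_subgroup_cyclic A : mul_subgroup A -> finite_set A ->
  let n := size (finmap.enum_fset (fset_set A)) in
  exists2 lam : K, n.-primitive_root lam & A = unity_roots n.
Proof.
move=> [A0 A1 AM AV] Afin; set r := finmap.enum_fset (fset_set A) => /=.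
have memr x : x \in r <-> A x.
  by have := in_fset_set Afin x; rewrite /r => ->; rewrite inE.
have ur : uniq r by exact: finmap.fset_uniq.
have n0 : (0 < size r)%N by move/memr: A1; case: (r).
have rn a : A a -> a ^+ size r = 1.
  move=> Aa; have a0 : a != 0 := A0 _ Aa.
  have P0 : \prod_(x <- r) x != 0.
    by rewrite prodf_seq_neq0; apply/allP => x /memr /A0.
  have PE : perm_eq (map ( *%R a) r) r.
    apply: uniq_perm => // [|x]; first by rewrite map_inj_uniq //; exact: mulfI.
    apply/mapP/idP => [[y /memr Ay ->]|/memr Ax]; first by apply/memr; exact: AM.
    exists (a^-1 * x); last by rewrite mulVKf.
    by apply/memr/AM => //; exact: AV.
  apply: (mulIf P0); rewrite mul1r -[RHS](perm_big _ PE) /=.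
  by rewrite big_map big_split /= big_const_seq count_predT iter_mulr mulr1.
have /hasP[lam /memr Alam lamn] : has (size r).-primitive_root r.
  apply: has_prim_root => //; apply/allP => x /memr /rn xn.
  by rewrite unity_rootE xn.
exists lam => //; apply/seteqP; split=> [a /rn //|a an].
have [i ->] := prim_rootP lamn an.
by elim: (i : nat) => [|k IH]; rewrite ?expr0 // exprS; exact: AM.
Qed.

Definition translations H : set K := [set v | H (sigma 1 v)].
Definition multipliers H : set K := [set a | exists b, H (sigma a b)].

Section Subgroup.
Variable H : set (endo K).
Hypothesis Hgrp : is_subgroup H.

Lemma subgroup_comp a b c d :
  H (sigma a b) -> H (sigma c d) -> H (sigma (a * c) (c * b + d)).
Proof. by case: Hgrp => _ _ HM _ Hs Ht; rewrite -sigma_comp; exact: HM. Qed.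

Lemma subgroup_neq0 a b : H (sigma a b) -> a != 0.
Proof. by case: Hgrp => HA _ _ _ /HA /sigma_aut_neq0. Qed.

Lemma subgroup_diff a b c :
  H (sigma a b) -> H (sigma a c) -> translations H (c - b).
Proof.
move=> Hb Hc; have a0 := subgroup_neq0 Hb.
have := subgroup_comp (subgroupV Hgrp a0 Hb) Hc.
by rewrite mulVf // mulrN mulVKf // addrC.
Qed.

Lemma translations_subgroup : add_subgroup (translations H).
Proof.
have [_ H1 _ _] := Hgrp; split; rewrite /translations /=.
- by rewrite sigma_id.
- by move=> u v Hu Hv; have := subgroup_comp Hu Hv; rewrite !mul1r.
- by move=> u Hu; have := subgroupV Hgrp (oner_neq0 _) Hu; rewrite invr1 mul1r.
Qed.

Lemma multipliers_subgroup : mul_subgroup (multipliers H).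
Proof.
have [_ H1 _ _] := Hgrp; split.
- by move=> a [b /subgroup_neq0].
- by exists 0; rewrite sigma_id.
- by move=> a c [b Hb] [d Hd]; exists (c * b + d); exact: subgroup_comp.
- move=> a [b Hb]; have a0 := subgroup_neq0 Hb.
  by exists (- (a^-1 * b)); exact: subgroupV.
Qed.

(** Composing the translation by [v] with [sigma a b] changes the constant term by [a * v]. *)
Lemma multipliers_stab a v :
  multipliers H a -> translations H v -> translations H (a * v).
Proof.
move=> [b Hb] Hv; have := subgroup_comp Hv Hb; rewrite mul1r => /(subgroup_diff Hb).
by rewrite addrK.
Qed.

(** Elements with the same multiplier differ by a translation, so one element fixing [nu] over each
    multiplier determines [H]. *)
Lemma subgroup_affine nu :
  (forall a, multipliers H a -> H (sigma a ((1 - a) * nu))) ->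
  H = affine (multipliers H) nu (translations H).
Proof.
move=> Hnu; have [HA _ _ _] := Hgrp.
apply: eq_aut_set => // [|a b _].
  by apply: affine_aut; case: multipliers_subgroup.
split=> [Hab|/affineP[/Hnu Ha Hb]]; last first.
  by have := subgroup_comp Ha Hb; rewrite mulr1 mul1r addrC subrK.
have Ha : multipliers H a by exists b.
by apply/affineP; split=> //; apply: subgroup_diff Hab; exact: Hnu.
Qed.

Lemma listed_of_finite :
  finite_set (translations H) -> finite_set (multipliers H) -> listed p H.
Proof.
move=> Vfin Afin; have Vgrp := translations_subgroup.
have Agrp := multipliers_subgroup.
have [lam] := mul_subgroup_cyclic Agrp Afin; set n := size _ => lamn An.
have [b Hlam] : multipliers H lam by rewrite An; exact: prim_expr_order.
have n0 := prim_order_gt0 lamn.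
have [n2|n1] := leqP 2 n; last first.
  have n1E : n = 1%N by apply/eqP; rewrite eqn_leq n0 -ltnS n1.
  have A1 : multipliers H = [set 1].
    rewrite An n1E; apply/seteqP; split=> a; rewrite /unity_roots /=.
      by rewrite expr1.
    by move=> ->; rewrite expr1n.
  have HE : H = affine [set 1] 0 (translations H).
    rewrite -A1; apply: subgroup_affine => a; rewrite A1 => -> /=.
    by rewrite subrr mul0r sigma_id; case: Hgrp.
  have [V0|V0] := EM (translations H = [set 0]).
    by apply: ListedTrivial; rewrite HE V0 affine_trivial.
  apply: (ListedSh (V := translations H)); first exact/nonzero_findimP.
  by rewrite -(affine_Sh 0).
have lam1 : 1 - lam != 0.
  rewrite subr_eq0 eq_sym -(expr1 lam) -(prim_order_dvd lamn) dvdn1.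
  by case: (n) n2 => [|[]].
(* The fixed point of [lam x + b]. *)
pose nu := b / (1 - lam).
have Hnu : H (sigma lam ((1 - lam) * nu)) by rewrite /nu mulrC divfK.
have HE : H = affine (unity_roots n) nu (translations H).
  rewrite -An; apply: subgroup_affine => a; rewrite An => an.
  have [i ->] := prim_rootP lamn an; exact: subgroup_sigmaX.
have [V0|V0] := EM (translations H = [set 0]).
  by apply: (ListedCyclic p n2 lamn (nu := nu)); rewrite -(affine_generated _ lamn) -V0.
have stab v : translations H v -> translations H (lam * v).
  by apply: multipliers_stab; exists b.
apply: (ListedSdprod (V := translations H) (nu := nu) _ n2 lamn stab).
  exact/nonzero_findimP.
by rewrite {1}HE; exact: affine_sdprod.
Qed.

End Subgroup.

Lemma finite_listed H : finite_set [set: K] -> is_subgroup H -> listed p H.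
Proof. by move=> Kfin Hgrp; apply: listed_of_finite => //; exact: sub_finite_set Kfin. Qed.

End Structure.

(** * Eigengroups of the exhibited polynomials *)

Section Eigengroups.
Variable K : fieldType.
Implicit Types (a b c nu : K) (f : {poly K}) (A V : set K).

Lemma eigengroup_aut f : eigengroup f `<=` AutPoly K.
Proof. by move=> s []. Qed.

Lemma shift_polyK f nu : shift_poly (shift_poly f nu) (- nu) = f.
Proof.
rewrite /shift_poly -comp_polyA comp_polyB comp_polyX comp_polyC polyCN opprK.
by rewrite addrK comp_polyXr.
Qed.

Lemma shift_poly_monic f nu : f \is monic -> shift_poly f nu \is monic.
Proof.
move=> /monicP f1; apply/monicP; rewrite /shift_poly -polyCN -['X]scale1r.
by rewrite lead_coef_comp_affine ?oner_neq0 // f1 expr1n mulr1.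
Qed.

(** In the coordinate [x - nu] the map [a x + b] has constant term [b - (1 - a) * nu]. *)
Lemma eigengroup_shift f nu a b :
  eigengroup (shift_poly f nu) (sigma a b) <->
  eigengroup f (sigma a (b - (1 - a) * nu)).
Proof.
suff E : shift_poly f nu \Po (a *: 'X + b%:P)
    = shift_poly (f \Po (a *: 'X + (b - (1 - a) * nu)%:P)) nu.
  have shZ c : shift_poly (c *: f) nu = c *: shift_poly f nu.
    by rewrite /shift_poly comp_polyZ.
  split=> /eigengroupP[a0 [c c0 Ec]]; apply/eigengroupP; split=> //; exists c => //.
    apply: (can_inj (fun f => shift_polyK f nu)).
    by rewrite -E Ec shZ.
  by rewrite E Ec shZ.
rewrite /shift_poly -!comp_polyA; congr (_ \Po _).
rewrite !(comp_polyB, comp_polyD) !comp_polyZ !comp_polyX !comp_polyC -!mul_polyC.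
ring.
Qed.

Lemma eigengroup_shift_affine f A V nu : V 0 ->
  (forall a b, eigengroup f (sigma a b) <-> A a /\ V b) ->
  eigengroup (shift_poly f nu) = affine A nu V.
Proof.
move=> V0 fAV; apply: eq_aut_set => [||a b _].
- exact: eigengroup_aut.
- apply: affine_aut => a Aa; have [_ /(_ (conj Aa V0))] := fAV a 0.
  by move=> /eigengroup_aut/sigma_aut_neq0.
- by rewrite eigengroup_shift affineP; exact: fAV.
Qed.

Lemma shift_poly0 f : shift_poly f 0 = f.
Proof. by rewrite /shift_poly subr0 comp_polyXr. Qed.

Lemma fV_set1 : fV [set 0] = 'X :> {poly K}.
Proof. by rewrite /fV fsbig_set1 subr0. Qed.

(** The case [V = 0], [nu = -1] of [eigengroup_fV_shift]. *)
Lemma eigengroup_double_root : let f : {poly K} := 'X * ('X + 1) ^+ 2 in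
  f \is monic /\ eigengroup f = [set idfun].
Proof.
move=> f; have V0 := @add_subgroup0 K.
have Vfin : finite_set [set 0 : K] by exact: finite_set1.
have nu0 : ~ [set 0 : K] (- 1) by apply/eqP; rewrite oppr_eq0 oner_neq0.
have X1 : 'X + 1 = 'X - (-1)%:P :> {poly K} by rewrite polyCN opprK.
split; first by rewrite monicMl ?monicX // X1 monic_exp // monicXsubC.
rewrite -(affine_trivial 0) -[f]shift_poly0.
apply: eigengroup_shift_affine => // a b.
have -> : f = fV [set 0] * shift_poly (fV [set 0]) (-1) ^+ 2.
  by rewrite fV_set1 /shift_poly comp_polyX /f X1.
exact: eigengroup_fV_shift.
Qed.

(** The case [V = 0], [e = -1] of [eigengroup_fVX]; a primitive [n]-th root of unity forces [n] to
    be nonzero in [K]. *)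
Lemma eigengroup_XsubC_Xn n lam nu : (2 <= n)%N -> n.-primitive_root lam ->
  let f : {poly K} := ('X - nu%:P) ^+ n - 1 in
  f \is monic /\ eigengroup f = generated (sigma lam ((1 - lam) * nu)).
Proof.
move=> n2 lamn f; have n0 := prim_order_gt0 lamn.
have -> : f = shift_poly (fV [set 0] ^+ n + (-1)%:P) nu.
  by rewrite fV_set1 /shift_poly comp_polyD rmorphXn /= comp_polyX comp_polyC polyCN.
split.
  by apply: shift_poly_monic; rewrite fV_set1 polyCN monicXnsubC.
rewrite -(affine_generated _ lamn); apply: eigengroup_shift_affine => // a b.
have nz : (-1 : K) != 0 by rewrite oppr_eq0 oner_neq0.
split=> [/(eigengroup_fVX (@add_subgroup0 K) (finite_set1 _) _ _ n2
  (prim_root_natf_neq0 lamn) nz)[]|[an b0]] //.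
apply/(eigengroup_fVX (@add_subgroup0 K) (finite_set1 _) _ _ n2
  (prim_root_natf_neq0 lamn) nz); split=> // v -> /=; exact: mulr0.
Qed.

Lemma eigengroup_XsubC nu : let f : {poly K} := 'X - nu%:P in
  f \is monic /\ eigengroup f = torus nu.
Proof.
move=> f; split; first exact: monicXsubC.
rewrite -affine_torus; have -> : f = shift_poly (fV [set 0]) nu.
  by rewrite fV_set1 /shift_poly comp_polyX.
apply: eigengroup_shift_affine => // a b.
split=> [/(eigengroup_fV (@add_subgroup0 K) (finite_set1 _))[]|[a0 b0]] //.
apply/(eigengroup_fV (@add_subgroup0 K) (finite_set1 _)); split=> // v -> /=.
exact: mulr0.
Qed.

Lemma eigengroup1 : eigengroup (1 : {poly K}) = AutPoly K.
Proof.
apply/seteqP; split=> s; first exact: eigengroup_aut.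
move=> As; split=> //; exists 1; first exact: oner_neq0.
by case: As => _ [s1 _] _; rewrite s1 scale1r.
Qed.

(** The polynomial is [fV] of the whole field, where the conditions in [eigengroup_fV] leave only
    [a != 0]. *)
Lemma eigengroup_Xq_subX q : [set: K] #= `I_q ->
  let f : {poly K} := 'X^q - 'X in f \is monic /\ eigengroup f = AutPoly K.
Proof.
move=> Kq f; have Kfin : finite_set [set: K] by exists q.
have Tgrp : add_subgroup [set: K] by [].
have sz := card_fset_set Kq.
have q2 : (1 < q)%N.
  rewrite -sz; apply: (@uniq_leq_size _ [:: 0 : K; 1]).
    by rewrite /= inE eq_sym oner_neq0.
  by move=> x _; apply/(mem_fset_setP Kfin).
have fm : f \is monic.
  by rewrite monicE lead_coefDl ?lead_coefXn // size_polyN size_polyX size_polyXn.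
split=> //; suff -> : f = fV [set: K].
  apply: eq_aut_set => // [|a b a0]; first exact: eigengroup_aut.
  split=> _; first exact: sigma_aut.
  exact/(eigengroup_fV Tgrp Kfin).
have sf : size f = q.+1.
  by rewrite size_polyDl ?size_polyXn // size_polyN size_polyX.
apply: (poly_eq_on_V Kfin) => [|x _].
  rewrite sz; apply: size_sub_lead => //; first by rewrite size_fV // sz.
  by rewrite (monicP fm) (monicP (fV_monic Kfin)).
rewrite (fV_eq0 Kfin) // !hornerE; apply/eqP; rewrite subr_eq0; apply/eqP.
have [->|x0] := eqVneq x 0; first by rewrite expr0n gtn_eqF // (ltn_trans _ q2).
by have := card_root_stab Tgrp Kfin x0 (fun _ _ => I); rewrite sz.
Qed.

(** * Nonzero finite [V] and its multiplier field *)

Section NonzeroSubspace.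
Variable V : set K.
Hypotheses (Vgrp : add_subgroup V) (Vfin : finite_set V) (VN0 : V <> [set 0]).

Lemma nonzero_mem : exists2 v, V v & v != 0.
Proof.
have [V0 _ _] := Vgrp; apply: contrapT => H; apply: VN0.
apply/seteqP; split=> [v Vv|_ -> //] /=.
by apply/eqP/negP => /negP v0; apply: H; exists v.
Qed.

(** Pigeonhole: [nu] and [nu + v] both go to 0, so a surjection would remain one after deleting [nu]
    from [K]. *)
Lemma fV_shift_not_surjective nu : finite_set [set: K] ->
  exists rho, ~ range (fun a => (fV V).[a - nu]) rho.
Proof.
move=> Kfin; apply: contrapT => H.
have surj rho : exists a, (fV V).[a - nu] = rho.
  apply: contrapT => Nrho; apply: H; exists rho => -[a _ E].
  by apply: Nrho; exists a.
have [v Vv v0] := nonzero_mem.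
set r := finmap.enum_fset (fset_set [set: K]).
have memr x : x \in r by apply/(mem_fset_setP Kfin).
have ur : uniq r by exact: finmap.fset_uniq.
have: (size r <= size [seq (fV V).[a - nu] | a <- rem nu r])%N.
  apply: uniq_leq_size => // rho _; have [a <-] := surj rho.
  have [->|anu] := eqVneq a nu.
    apply/mapP; exists (nu + v); last first.
      by rewrite subrr addrAC subrr add0r fV_horner0 // fV_eq0.
    by rewrite mem_rem_uniq // inE memr andbT -subr_eq0 addrAC subrr add0r.
  by apply/mapP; exists a; rewrite // mem_rem_uniq // inE memr andbT.
by rewrite size_map size_rem // leqNgt prednK ?leqnn //; case: (r) (memr 0).
Qed.

Lemma eigengroup_shift_fV_sub nu rho :
  ~ range (fun a => (fV V).[a - nu]) rho ->
  let f := shift_poly (fV V) nu - rho%:P in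
  f \is monic /\ eigengroup f = Sh V.
Proof.
move=> Nrho f; have [V0 _ _] := Vgrp.
have -> : f = shift_poly (fV V - rho%:P) nu.
  by rewrite /shift_poly comp_polyB comp_polyC.
split.
  apply: shift_poly_monic; apply/monicP.
  rewrite lead_coefDl ?(monicP (fV_monic Vfin)) // size_polyN size_fV // ltnS.
  by rewrite (leq_trans (size_polyC_leq1 _)) ?fV_card_gt0.
rewrite -(affine_Sh nu); apply: eigengroup_shift_affine => // a b.
apply: eigengroup_fV_sub => // x; apply/eqP => E; apply: Nrho.
by exists (x + nu); rewrite // addrK.
Qed.

Lemma eigengroup_fV_shift_sqr nu : ~ V nu ->
  let f := fV V * shift_poly (fV V) nu ^+ 2 in
  f \is monic /\ eigengroup f = Sh V.
Proof.
move=> Vnu f; have [V0 _ _] := Vgrp; have gm := fV_monic Vfin; split.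
  by rewrite monicMl // monic_exp // shift_poly_monic.
rewrite -(affine_Sh 0) -[f]shift_poly0; apply: eigengroup_shift_affine => // a b.
exact: eigengroup_fV_shift.
Qed.

Lemma eigengroup_shift_fVX n lam nu : (2 <= n)%N -> n.-primitive_root lam ->
  (forall v, V v -> V (lam * v)) ->
  let f := shift_poly (fV V) nu ^+ n + 1 in
  f \is monic /\ eigengroup f = affine (unity_roots n) nu V.
Proof.
move=> n2 lamn Vlam f; have [V0 _ _] := Vgrp; have gm := fV_monic Vfin.
have -> : f = shift_poly (fV V ^+ n + 1%:P) nu.
  by rewrite /shift_poly comp_polyD rmorphXn /= comp_polyC.
split.
  apply: shift_poly_monic; apply/monicP; rewrite lead_coefDl.
    exact/monicP/monic_exp.
  rewrite size_fVX // size_poly1 ltnS muln_gt0 fV_card_gt0 //=.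
  exact: prim_order_gt0 lamn.
apply: eigengroup_shift_affine => // a b.
rewrite eigengroup_fVX ?oner_neq0 ?(prim_root_natf_neq0 lamn) //.
split=> [[]|[an Vb]] //; split=> // v; exact: (unity_roots_stab lamn Vlam an).
Qed.

(** Serves the case where the [n]-th roots of unity are the whole multiplicative group of the
    multiplier field. *)
Lemma eigengroup_shift_fV n nu :
  (forall a, a ^+ n = 1 <-> a != 0 /\ forall v, V v -> V (a * v)) ->
  let f := shift_poly (fV V) nu in
  f \is monic /\ eigengroup f = affine (unity_roots n) nu V.
Proof.
move=> stabE f; have [V0 _ _] := Vgrp; have gm := fV_monic Vfin.
split; first exact: shift_poly_monic.
apply: eigengroup_shift_affine => // a b; rewrite eigengroup_fV // /unity_roots /=.
by rewrite stabE; split=> [[]|[[]]].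
Qed.

Definition stabilizer : set K := [set a | forall v, V v -> V (a * v)].

(** Finiteness holds since [a] is recovered from [a * v0] in [V]. For inverses, homogeneity of
    [fV V] shows that [b^-1 * v] is again a root. *)
Lemma stabilizer_subfield : is_finite_subfield stabilizer.
Proof.
have [V0 VD VN] := Vgrp; have [v0 Vv0 v0N] := nonzero_mem.
split; rewrite /stabilizer /=.
- apply: (@sub_finite_set _ _ ((fun x => x / v0) @` V)); last exact: finite_image.
  by move=> a Va; exists (a * v0); [exact: Va|rewrite mulfK].
- by move=> v; rewrite mul1r.
- by move=> a b Va Vb v Vv; rewrite mulrBl; apply: VD; [exact: Va|exact/VN/Vb].
- move=> a b Va Vb v Vv; rewrite -mulrA; apply: Va.
  (* With the convention [0^-1 = 0], division by 0 yields 0, which stabilizes [V]. *)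
  have [->|b0] := eqVneq b 0; first by rewrite invr0 mul0r.
  apply/(root_fV Vfin)/(mulfI b0); rewrite -fV_hornerM // mulVKf // mulr0.
  exact: fV_eq0.
Qed.

(** The stabilizer is itself a finite subfield, so maximality of [L] applies to it. *)
Lemma multiplier_field_stabilizer L : is_multiplier_field L V -> L = stabilizer.
Proof.
move=> [_ LV Lmax]; apply/seteqP; split=> [a La v|]; first exact: LV.
by apply: Lmax => [|a v Sa Vv]; [exact: stabilizer_subfield|exact: Sa].
Qed.

(** The nonzero elements of the stabilizer form a finite, hence cyclic, multiplicative group;
    removing 0 accounts for [N.-1]. *)
Lemma stabilizer_unity_roots N : stabilizer #= `I_N ->
  (0 < N.-1)%N /\
  forall a, a ^+ N.-1 = 1 <-> a != 0 /\ forall v, V v -> V (a * v).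
Proof.
move=> SN; have [Sfin S1 SB SM] := stabilizer_subfield.
have V0 : stabilizer 0 by rewrite -(subrr 1); exact: SB.
pose A := stabilizer `&` [set a | a != 0].
have Afin : finite_set A by apply: sub_finite_set Sfin => a [].
have Agrp : mul_subgroup A.
  split=> [a []//||a b [Sa a0] [Sb b0]|a [Sa a0]].
  - by split=> //; exact: oner_neq0.
  - split; last exact: mulf_neq0.
    rewrite -[b]invrK; apply: (SM) => //; rewrite -div1r; exact: SM.
  - by split; [rewrite -div1r; exact: SM|exact: invr_neq0].
have [lam] := mul_subgroup_cyclic Agrp Afin; set r := finmap.enum_fset _.
move=> lamn AE; have n0 := prim_order_gt0 lamn.
have NE : N = (size r).+1.
  rewrite -(card_fset_set SN) -[RHS]/(size (0 :: r)); apply: perm_size.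
  have memr x : x \in r <-> A x by exact: mem_fset_setP.
  apply: uniq_perm; first exact: finmap.fset_uniq.
    rewrite /= finmap.fset_uniq andbT; apply/negP => /memr[_] /=.
    by rewrite eqxx.
  move=> x; rewrite inE; apply/idP/predU1P => [/(mem_fset_setP Sfin) Sx|[->|]].
  - by have [|x0] := eqVneq x 0; [left|right; apply/memr].
  - exact/(mem_fset_setP Sfin).
  - by move=> /memr[Sx _]; apply/(mem_fset_setP Sfin).
rewrite NE /=; split=> // a; rewrite -[_ = 1]/(unity_roots (size r) a) -AE.
by split=> -[].
Qed.

End NonzeroSubspace.
End Eigengroups.

(** * The listed subgroups are exactly the eigengroups of monic polynomials that are subgroups *)

Section Classification.
Variables (K : fieldType) (p : nat).
Hypothesis charKp : p \in [pchar K].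
Implicit Types (a b c nu : K) (f : {poly K}).

Lemma finite_roots f : f != 0 -> finite_set [set x | root f x].
Proof.
move=> f0; apply: contrapT => /(infinite_set_fset (size f))[B rB].
rewrite leqNgt => /negP[]; apply: max_poly_roots => //; last exact: finmap.fset_uniq.
by apply/allP => x xB; exact: rB.
Qed.

Lemma comp_poly_scaleX f a i : (f \Po (a *: 'X))`_i = a ^+ i * f`_i.
Proof.
rewrite coef_comp_poly; have [ltif|leif] := ltnP i (size f).
  rewrite (bigD1 (Ordinal ltif)) //= big1 ?addr0 => [|j].
    by rewrite exprZn coefZ coefXn eqxx mulr1 mulrC.
  by rewrite -val_eqE /= => /negPf ji; rewrite exprZn coefZ coefXn eq_sym ji !mulr0.
rewrite nth_default // mulr0 big1 // => j _.
by rewrite exprZn coefZ coefXn gtn_eqF ?mulr0 // (leq_trans (ltn_ord j)).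
Qed.

Lemma finite_translations f : f \is monic -> (1 < size f)%N ->
  finite_set (translations (eigengroup f)).
Proof.
move=> fm sf; have nz : f - f.[0]%:P != 0.
  by rewrite subr_eq0; apply: contraTneq sf => ->; rewrite -leqNgt size_polyC_leq1.
apply: sub_finite_set (finite_roots nz) => v /eigengroupP[_ [c _ E]].
(* A translation preserves the leading coefficient. *)
have c1 : c = 1.
  have := congr1 lead_coef E; rewrite lead_coef_comp_affine ?oner_neq0 //.
  by rewrite lead_coefZ (monicP fm) expr1n !mulr1.
have := congr1 (horner^~ 0) E; rewrite /= horner_comp_affine c1 scale1r mulr0 add0r.
by move=> fv; rewrite /root !hornerE fv subrr.
Qed.

(* Infinitely many multipliers force [V = 0]; then the group is abelian, so all
   its elements share a fixed point [nu], and [f] is homogeneous at [nu]. *)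
Lemma eigengroup_torus f : f \is monic -> (1 < size f)%N ->
  is_subgroup (eigengroup f) -> infinite_set (multipliers (eigengroup f)) ->
  exists nu, eigengroup f = torus nu.
Proof.
move=> fm sf Hgrp; set H := eigengroup f => Minf.
have Vfin : finite_set (translations H) by exact: finite_translations.
have Vgrp := translations_subgroup Hgrp; have [V0 _ _] := Vgrp.
have VE : translations H = [set 0].
  (* For [v != 0], the map sending [a] to [a * v] would embed the multipliers in the finite [V]. *)
  apply: contrapT => /(nonzero_mem Vgrp)[v Vv v0]; apply: Minf.
  apply: (@sub_finite_set _ _ ((fun x => x / v) @` translations H)).
    by move=> a Ma; exists (a * v); [exact: multipliers_stab|rewrite mulfK].
  exact: finite_image.
have [lam [[b Hlam] /eqP lam1]] : multipliers H `\` [set 1] !=set0.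
  by apply/infinite_setN0/infinite_setD => //; exact: finite_set1.
have lam1N : 1 - lam != 0 by rewrite subr_eq0 eq_sym.
pose nu := b / (1 - lam).
(* The two composites with [sigma lam b] have the same multiplier, so their constant terms differ by
   a translation, that is, by 0. *)
have Hnu a b' : H (sigma a b') -> b' = (1 - a) * nu.
  move=> Ha; have H1 := subgroup_comp Hgrp Ha Hlam.
  have := subgroup_diff Hgrp H1 _ (c := a * b + b').
  rewrite VE /= [a * lam]mulrC => /(_ (subgroup_comp Hgrp Hlam Ha)) /eqP.
  rewrite subr_eq0 => /eqP E; apply: (mulfI lam1N); rewrite /nu.
  transitivity ((1 - a) * b); last by field.
  by have -> : (1 - lam) * b' = (a * b + b') - lam * b' - a * b by [ring];
    rewrite E; ring.
have MH a : multipliers H a -> H (sigma a ((1 - a) * nu)).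
  by move=> [b' Ha]; rewrite -(Hnu _ _ Ha).
pose F := shift_poly f (- nu).
have fF : shift_poly F nu = f by have := shift_polyK f (- nu); rewrite opprK.
have HF a : H (sigma a ((1 - a) * nu)) <-> eigengroup F (sigma a 0).
  by rewrite /H -fF eigengroup_shift subrr.
have Fm : F \is monic by exact: shift_poly_monic.
(* A nonzero coefficient at some lower [i] would make every multiplier a root of the nonzero
   ['X^i - 'X^((size F).-1)]. *)
have FX : F = 'X^((size F).-1).
  apply/polyP => i; rewrite coefXn; have [-> | iN] := eqVneq.
    by rewrite -lead_coefE (monicP Fm).
  have [leFi|ltiF] := leqP (size F) i; first by rewrite nth_default.
  apply: contrapT => /eqP Fi0; apply: Minf.
  have nz : 'X^i - 'X^((size F).-1) != 0 :> {poly K}.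
    apply/eqP => /(congr1 (fun g : {poly K} => g`_i)).
    by rewrite !coefE eqxx (negPf iN) subr0 => /eqP; rewrite oner_eq0.
  apply: sub_finite_set (finite_roots nz) => a /MH/HF/eigengroupP[_ [c _]].
  rewrite addr0 => E.
  have Ei j : a ^+ j * F`_j = c * F`_j by rewrite -comp_poly_scaleX E coefZ.
  have := Ei (size F).-1; rewrite -lead_coefE (monicP Fm) !mulr1 => ac.
  have /(mulIf Fi0) ai := Ei i.
  by rewrite /= /root !hornerE ai ac subrr.
exists nu; rewrite -affine_torus -VE.
rewrite [LHS](subgroup_affine Hgrp MH); congr (affine _ _ _).
apply/seteqP; split=> a; first by case: (multipliers_subgroup Hgrp) => M0 _ _ _ /M0.
move=> a0; exists ((1 - a) * nu); apply/HF/eigengroupP; split=> //.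
exists (a ^+ (size F).-1); first exact: expf_neq0.
by rewrite FX addr0 comp_Xn_poly exprZn size_polyXn.
Qed.

Lemma eigengroup_listed f : f \is monic -> is_subgroup (eigengroup f) ->
  listed p (eigengroup f).
Proof.
move=> fm Hgrp; have [sf|sf] := leqP (size f) 1.
  have f1 : f = 1.
    by have := monicP fm; rewrite (size1_polyC sf) lead_coefC => ->.
  by apply: ListedAut; rewrite f1 eigengroup1.
have Vfin := finite_translations fm sf.
have [Mfin|Minf] := EM (finite_set (multipliers (eigengroup f))).
  exact: listed_of_finite.
by have [nu HE] := eigengroup_torus fm sf Hgrp Minf; exact: (ListedTorus _ HE).
Qed.

Lemma infinite_notin (V : set K) :
  infinite_set [set: K] -> finite_set V -> exists nu, ~ V nu.
Proof.
by move=> Kinf Vfin; have [nu []] := infinite_setN0 (infinite_setD Kinf Vfin); exists nu.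
Qed.

Lemma listed_eigengroup (H : set (endo K)) : listed p H ->
  exists2 f : {poly K}, f \is monic & eigengroup f = H.
Proof.
case=> [->|n lam nu n2 lamn ->|V /(nonzero_findimP charKp)[Vgrp Vfin VN0] ->
       |V n lam nu /(nonzero_findimP charKp)[Vgrp Vfin VN0] n2 lamn Vlam HE|nu ->|->].
- by have [fm fE] := eigengroup_double_root K; exists ('X * ('X + 1) ^+ 2).
- by have [fm fE] := eigengroup_XsubC_Xn nu n2 lamn; eexists; [exact: fm|].
- have [Kfin|Kinf] := EM (finite_set [set: K]).
    have [rho Nrho] := fV_shift_not_surjective Vgrp Vfin VN0 0 Kfin.
    by have [fm fE] := eigengroup_shift_fV_sub Vgrp Vfin Nrho; eexists; [exact: fm|].
  have [nu Vnu] := infinite_notin Kinf Vfin.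
  by have [fm fE] := eigengroup_fV_shift_sqr Vgrp Vfin Vnu; eexists; [exact: fm|].
- have [fm fE] := eigengroup_shift_fVX Vgrp Vfin nu n2 lamn Vlam.
  eexists; first exact: fm.
  (* Both groups are the set of products of the same two factors. *)
  rewrite fE; have [_ _ _ _ ->] := HE.
  by have [_ _ _ _ ->] := affine_sdprod nu lamn Vgrp Vlam.
- by have [fm fE] := eigengroup_XsubC nu; eexists; [exact: fm|].
- have [[q Kq]|Kinf] := EM (finite_set [set: K]).
    by have [fm fE] := eigengroup_Xq_subX Kq; eexists; [exact: fm|].
  by exists 1; [exact: monic1|exact: eigengroup1].
Qed.

End Classification.

Theorem theorem4p26 (K : fieldType) (p : nat) (charKp : p \in [pchar K]) :
  (* existence: every subgroup when K is finite, and in general exactly the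
     subgroups listed in 1-6 *)
  (forall H : set (endo K), is_subgroup H ->
     (finite_set [set: K] -> listed p H) /\
     (listed p H <-> exists2 f : {poly K}, f \is monic & eigengroup f = H))
  /\
  (* 1 *)
  (let f : {poly K} := 'X * ('X + 1) ^+ 2 in
   f \is monic /\ eigengroup f = [set idfun])
  /\
  (* 2 *)
  (forall (n : nat) (lam nu : K), (2 <= n)%N -> n.-primitive_root lam ->
     let f : {poly K} := ('X - nu%:P) ^+ n - 1 in
     f \is monic /\ eigengroup f = generated (sigma lam ((1 - lam) * nu)))
  /\
  (* 3 *)
  (forall V : set K, nonzero_findim_subspace p V ->
     (* (a) *)
     (forall n : nat, [set: K] #= `I_(p ^ n) ->
        forall nu : K,
          (exists rho : K, ~ range (fun a : K => (fV V).[a - nu]) rho) /\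
          (forall rho : K, ~ range (fun a : K => (fV V).[a - nu]) rho ->
             let f := shift_poly (fV V) nu - rho%:P in
             f \is monic /\ eigengroup f = Sh V))
     /\
     (* (b) *)
     (infinite_set [set: K] ->
        (exists nu : K, ~ V nu) /\
        (forall nu : K, ~ V nu ->
           let f := fV V * shift_poly (fV V) nu ^+ 2 in
           f \is monic /\ eigengroup f = Sh V)))
  /\
  (* 4 *)
  (forall (V L : set K) (e n : nat) (lam nu : K),
     nonzero_findim_subspace p V ->
     is_multiplier_field L V -> L #= `I_(p ^ e) ->
     (2 <= n)%N -> n.-primitive_root lam ->
     (forall v, V v -> V (lam * v)) ->
     let C := generated (sigma lam ((1 - lam) * nu)) in
     [/\ (n <= p ^ e - 1)%N,
         n = (p ^ e - 1)%N ->
           let f := shift_poly (fV V) nu in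
           f \is monic /\ is_sdprod (eigengroup f) (Sh V) C
       & (n < p ^ e - 1)%N ->
           let f := shift_poly (fV V) nu ^+ n + 1 in
           f \is monic /\ is_sdprod (eigengroup f) (Sh V) C])
  /\
  (* 5 *)
  (forall nu : K,
     let f : {poly K} := 'X - nu%:P in
     f \is monic /\ eigengroup f = torus nu)
  /\
  (* 6 *)
  (infinite_set [set: K] ->
     (1 : {poly K}) \is monic /\ eigengroup (1 : {poly K}) = AutPoly K)
  /\
  (forall n : nat, [set: K] #= `I_(p ^ n) ->
     let f : {poly K} := 'X^(p ^ n) - 'X in
     f \is monic /\ eigengroup f = AutPoly K).
Proof.
split.
  move=> H Hgrp; split=> [Kfin|]; first exact: finite_listed.
  split; first exact: listed_eigengroup.
  by move=> [f fm fE]; rewrite -fE in Hgrp *; exact: eigengroup_listed.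
split; first exact: eigengroup_double_root.
split; first by move=> n lam nu; exact: eigengroup_XsubC_Xn.
split.
  move=> V /(nonzero_findimP charKp)[Vgrp Vfin VN0]; split=> [n Kn nu|Kinf].
    split; first by apply: fV_shift_not_surjective => //; exists (p ^ n)%N.
    by move=> rho; exact: eigengroup_shift_fV_sub.
  split; first exact: infinite_notin.
  by move=> nu; exact: eigengroup_fV_shift_sqr.
split.
  move=> V L e n lam nu /(nonzero_findimP charKp)[Vgrp Vfin VN0].
  move=> /(multiplier_field_stabilizer Vgrp Vfin VN0) -> Le n2 lamn Vlam C.
  have [N0 stabE] := stabilizer_unity_roots Vgrp Vfin VN0 Le.
  have sdprod := affine_sdprod nu lamn Vgrp Vlam.
  rewrite subn1; split=> [|nE f|_ f].
  (* [lam] lies in the multiplicative group of the multiplier field, so its order divides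
     [p ^ e - 1]. *)
  - apply: dvdn_leq => //; rewrite (prim_order_dvd lamn); apply/eqP/stabE.
    split=> //; apply: unity_root_neq0 (prim_expr_order lamn).
    exact: prim_order_gt0 lamn.
  - rewrite -nE in stabE; have [fm fE] := eigengroup_shift_fV Vgrp Vfin nu stabE.
    by split=> //; rewrite fE.
  - have [fm fE] := eigengroup_shift_fVX Vgrp Vfin nu n2 lamn Vlam.
    by split=> //; rewrite fE.
split; first exact: eigengroup_XsubC.
split; first by split; [exact: monic1|exact: eigengroup1].
by move=> n; exact: eigengroup_Xq_subX.
Qed.
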